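(* Let $G$ be a simple symmetric graph with $2n+1$ vertices, let $\mathcal{B}_{\mathrm{tor}}(G)$ be its graphical toric hyperplane arrangement in $\mathbb{R}^n/\mathbb{Z}^n$, and let $\beta_G:(\mathbb{R}^n/\mathbb{Z}^n-\mathcal{B}_{\mathrm{tor}}(G))\to\mathrm{Acyc}(G)$ be the map $x\mapsto\omega(x)$ defined in the context. Then $\beta_G$ induces a bijection $\bar\beta_G:\mathrm{Cham}(\mathcal{B}_{\mathrm{tor}}(G))\to\mathrm{Acyc}(G)/{\sim}$, sending the chamber containing $x$ to the class of $\beta_G(x)$. In other words, two points $x,y\in\mathbb{R}^n/\mathbb{Z}^n-\mathcal{B}_{\mathrm{tor}}(G)$ lie in the same chamber in $\mathrm{Cham}(\mathcal{B}_{\mathrm{tor}}(G))$ if and only if $\beta_G(x)\sim\beta_G(y)$ (and every class in $\mathrm{Acyc}(G)/{\sim}$ arises from some chamber).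
   Context: A symmetric graph is a graph $G=(V,E)$ on vertices $V=\{v_{-n},\dots,v_0,\dots,v_n\}$ such that if $(v_i,v_j)\in E$ then $(v_{-i},v_{-j})\in E$. It is simple if it has no loops and no multiple edges. A symmetric acyclic orientation of $G$ is an acyclic orientation of $G$ such that if $v_i\to v_j$ then $v_{-j}\to v_{-i}$; $\mathrm{Acyc}(G)$ is the set of these. If $i\neq0$ and $v_i$ is a source (resp. sink) of such an orientation $\omega$, then $v_{-i}$ is a sink (resp. source); if moreover $v_iv_{-i}$ is not an edge of $G$, then $(v_i,v_{-i})$ is called a source-sink pair of $\omega$. Reversing the direction of all edges adjacent to $v_i$ or $v_{-i}$ for a source-sink pair gives another symmetric acyclic orientation $\omega'$, and one says $\omega$ and $\omega'$ differ by a flip. The relation $\sim$ is the equivalence relation on $\mathrm{Acyc}(G)$ given by the transitive closure of flips. Let $\pi:\mathbb{R}^n\to\mathbb{R}^n/\mathbb{Z}^n$ be the projection. The graphical toric hyperplane arrangement $\mathcal{B}_{\mathrm{tor}}(G)$ is the union of the images under $\pi$ of the following hyperplanes of $\mathbb{R}^n$: $\{x_i-x_j=0\}$ for $0<i<j\le n$ with $(v_i,v_j)\in E$; $\{x_i+x_j=0\}$ for $0<i<j\le n$ with $(v_i,v_{-j})\in E$; $\{x_i=0\}$ for $0<i\le n$ with $(v_0,v_i)\in E$; and both $\{x_i=0\}$ and $\{2x_i=1\}$ for $0<i\le n$ with $(v_i,v_{-i})\in E$. $\mathrm{Cham}(\mathcal{B}_{\mathrm{tor}}(G))$ denotes the set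 of connected components (chambers) of $\mathbb{R}^n/\mathbb{Z}^n-\mathcal{B}_{\mathrm{tor}}(G)$. For $x\in\mathbb{R}^n/\mathbb{Z}^n-\mathcal{B}_{\mathrm{tor}}(G)$, choose the unique coordinates $(x_1,\dots,x_n)$ of $x$ with each $x_i\in(-0.5,0.5]$, and put $x_0=0$ and $x_{-i}=-x_i$ for $1\le i\le n$. The orientation $\omega(x)\in\mathrm{Acyc}(G)$ directs each edge $v_iv_j\in E$ ($i,j\in\{-n,\dots,n\}$), for which necessarily $x_i\ne x_j$, as $v_j\to v_i$ if $x_i<x_j$ and as $v_i\to v_j$ if $x_i>x_j$. *)

(* Defs.v *)
From HB Require Import structures.
From mathcomp Require Import all_boot all_order all_algebra.
From mathcomp Require Import all_classical all_reals all_analysis.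
From mathcomp Require Import lra.

Set Implicit Arguments.
Unset Strict Implicit.
Unset Printing Implicit Defensive.
Import Order.TTheory GRing.Theory Num.Theory.
Import numFieldNormedType.Exports.
Local Open Scope ring_scope.
Local Open Scope quotient_scope.

(* The 2n+1 vertices v_{-n}, ..., v_n.  Ordinals are 0-based: for i : 'I_n,
   [vpos i] is v_{i+1} and [vneg i] is v_{-(i+1)}. *)
Definition vertex (n : nat) : Type := option ('I_n + 'I_n).
HB.instance Definition _ n := Finite.on (vertex n).

Definition v0 {n} : vertex n := None.
Definition vpos {n} (i : 'I_n) : vertex n := Some (inl i).
Definition vneg {n} (i : 'I_n) : vertex n := Some (inr i).

Definition vopp {n} (v : vertex n) : vertex n :=
  match v with
  | None => v0
  | Some (inl i) => vneg i
  | Some (inr i) => vpos i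
  end.

Lemma card_vertex n : #|{: vertex n}| = n.*2.+1.
Proof. by rewrite card_option card_sum card_ord addnn. Qed.

Lemma voppK n : involutive (@vopp n).
Proof. by case=> [[i|i]|]. Qed.

Record symGraph (n : nat) := SymGraph {
  edge : rel (vertex n);
  edge_sym : symmetric edge;
  edge_irr : irreflexive edge;
  edge_opp : forall u v, edge u v -> edge (vopp u) (vopp v) }.

Section Orientations.
Context (n : nat) (G : symGraph n).
Implicit Types (w : {set vertex n * vertex n}) (u v : vertex n).

(* A set w of arcs, (u, v) \in w standing for u -> v. *)
Definition dir w : rel (vertex n) := fun u v => (u, v) \in w.

Definition orientation w : Prop :=
  (forall u v, dir w u v -> edge G u v) /\
  (forall u v, edge G u v -> dir w u v (+) dir w v u).

Definition sym_orientation w : Prop :=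
  forall u v, dir w u v -> dir w (vopp v) (vopp u).

Definition acyclic w : Prop := forall c, cycle (dir w) c -> c = [::].

Definition sym_acyclic w : Prop :=
  [/\ orientation w, sym_orientation w & acyclic w].

Definition Acyc : Type :=
  {w : {set vertex n * vertex n} | `[< sym_acyclic w >]}.
HB.instance Definition _ := SubFinite.on Acyc.

Definition is_source w v : bool := [forall u, ~~ dir w u v].
Definition is_sink w v : bool := [forall u, ~~ dir w v u].

(* (v, vopp v) is a source-sink pair of w; the opposite vertex is then
   automatically a sink, resp. a source, by symmetry of w. *)
Definition source_sink w v : bool :=
  [&& v != v0, ~~ edge G v (vopp v) & is_source w v || is_sink w v].

Definition touches v (a : vertex n * vertex n) : bool :=
  [|| a.1 == v, a.1 == vopp v, a.2 == v | a.2 == vopp v].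

Definition reverse_at w v : {set vertex n * vertex n} :=
  [set a | if touches v a then dir w a.2 a.1 else dir w a.1 a.2]%SET.

Definition flip (w w' : Acyc) : bool :=
  [exists v, source_sink (val w) v && (val w' == reverse_at (val w) v)].

Lemma touchesC v a b : touches v (a, b) = touches v (b, a).
Proof.
by rewrite /touches /=; case: (a == v); case: (a == vopp v);
  case: (b == v); case: (b == vopp v).
Qed.

Lemma reverse_atK w v : reverse_at (reverse_at w v) v = w.
Proof.
apply/setP => -[a b]; rewrite inE /dir !inE /= -(touchesC v a b).
by case: (touches v (a, b)).
Qed.

Lemma source_sink_reverse (w w' : Acyc) v : source_sink (val w) v ->
  val w' = reverse_at (val w) v -> source_sink (val w') v.
Proof.
move=> /and3P[v0 ev ss] ->; rewrite /source_sink v0 ev /=.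
case/orP: ss => /forallP s; apply/orP; [right|left]; apply/forallP => u;
  by have := s u; rewrite /dir !inE /touches /= eqxx ?orbT.
Qed.

Lemma flip_sym : symmetric flip.
Proof.
suff s (x y : Acyc) : flip x y -> flip y x.
  by move=> x y; apply/idP/idP; exact: s.
case/existsP => v /andP[ss /eqP e]; apply/existsP; exists v.
by rewrite (source_sink_reverse ss e) e reverse_atK eqxx.
Qed.

Definition flip_eqv : rel Acyc := connect flip.

Lemma flip_eqv_refl : reflexive flip_eqv. Proof. exact: connect0. Qed.
Lemma flip_eqv_sym : symmetric flip_eqv.
Proof. exact: sym_connect_sym flip_sym. Qed.
Lemma flip_eqv_trans : transitive flip_eqv.
Proof. exact: connect_trans. Qed.

Canonical flip_eqv_equiv :=
  EquivRel flip_eqv flip_eqv_refl flip_eqv_sym flip_eqv_trans.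

Definition AcycClasses : Type := {eq_quot flip_eqv}.
HB.instance Definition _ := Choice.on AcycClasses.
HB.instance Definition _ := EqQuotient.on AcycClasses.

End Orientations.

Section Torus.
Context (R : realType) (n : nat).

Definition lattice_eqv : rel 'rV[R]_n :=
  fun x y => [forall i, x 0 i - y 0 i \is a Num.int].

Lemma lattice_eqv_refl : reflexive lattice_eqv.
Proof. by move=> x; apply/forallP => i; rewrite subrr rpred0. Qed.
Lemma lattice_eqv_sym : symmetric lattice_eqv.
Proof. by move=> x y; apply: eq_forallb => i; rewrite -rpredN opprB. Qed.
Lemma lattice_eqv_trans : transitive lattice_eqv.
Proof.
move=> y x z /forallP xy /forallP yz; apply/forallP => i.
by rewrite -(subrKA (y 0 i)) rpredD.
Qed.

Canonical lattice_eqv_equiv :=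
  EquivRel lattice_eqv lattice_eqv_refl lattice_eqv_sym lattice_eqv_trans.

(* R^n / Z^n *)
Definition torus : Type := quotient_topology {eq_quot lattice_eqv}.
HB.instance Definition _ := Topological.on torus.
HB.instance Definition _ := Quotient.on torus.

Definition to_torus (x : 'rV[R]_n) : torus := \pi_{eq_quot lattice_eqv} x.

(* The representative of a real number modulo 1 in (-1/2, 1/2]. *)
Definition centered (a : R) : R := a - (Num.ceil (a - 2^-1))%:~R.

Definition coords (x : torus) : 'rV[R]_n := \row_i centered (repr x 0 i).

Lemma to_torusP (x y : 'rV[R]_n) :
  to_torus x = to_torus y <-> forall i, x 0 i - y 0 i \is a Num.int.
Proof.
split=> [/eqmodP/forallP //|h]; apply/eqmodP; exact/forallP.
Qed.

Lemma coords_itv x i : - 2^-1 < coords x 0 i <= 2^-1.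
Proof.
rewrite mxE /centered; set a := repr x 0 i.
have /andP[] := ceil_itv (a - 2^-1); rewrite rmorphB /= => lo hi.
by apply/andP; split; lra.
Qed.

Lemma to_torus_coords x : to_torus (coords x) = x.
Proof.
rewrite -[RHS](reprK (x : {eq_quot lattice_eqv})); apply/to_torusP => i.
by rewrite mxE /centered addrC addKr rpredN intr_int.
Qed.

Lemma coords_uniq x (y : 'rV[R]_n) :
  (forall i, - 2^-1 < y 0 i <= 2^-1) -> to_torus y = x -> y = coords x.
Proof.
rewrite -{1}(to_torus_coords x) => hy /to_torusP h; apply/rowP => i.
have /intrP[m hm] := h i.
have /andP[y1 y2] := hy i; have /andP[c1 c2] := coords_itv x i.
have m1 : m%:~R < 1%:~R :> R by rewrite -hm /=; lra.
have m2 : (-1)%:~R < m%:~R :> R by rewrite -hm rmorphN /=; lra.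
rewrite !ltr_int in m1 m2.
have m0 : m = 0.
  by case: m {hm} m1 m2 => [[|k]|[|k]].
by apply/eqP; rewrite -subr_eq0 hm m0.
Qed.

Local Open Scope classical_set_scope.

Inductive hyperplanes (G : symGraph n) : set (set 'rV[R]_n) :=
| hyp_diff (i j : 'I_n) of (i < j)%N & edge G (vpos i) (vpos j) :
    hyperplanes G [set x | x 0 i - x 0 j = 0]
| hyp_sum (i j : 'I_n) of (i < j)%N & edge G (vpos i) (vneg j) :
    hyperplanes G [set x | x 0 i + x 0 j = 0]
| hyp_zero (i : 'I_n) of edge G v0 (vpos i) :
    hyperplanes G [set x | x 0 i = 0]
| hyp_opp_zero (i : 'I_n) of edge G (vpos i) (vneg i) :
    hyperplanes G [set x | x 0 i = 0]
| hyp_opp_half (i : 'I_n) of edge G (vpos i) (vneg i) :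
    hyperplanes G [set x | 2 * x 0 i = 1].

Definition Btor (G : symGraph n) : set torus :=
  \bigcup_(H in hyperplanes G) (to_torus @` H).

Definition vcoord (x : torus) (v : vertex n) : R :=
  match v with
  | None => 0
  | Some (inl i) => coords x 0 i
  | Some (inr i) => - coords x 0 i
  end.

Lemma vcoord_opp x v : vcoord x (vopp v) = - vcoord x v.
Proof. by case: v => [[i|i]|] /=; rewrite ?opprK ?oppr0. Qed.

Definition omega (G : symGraph n) (x : torus) : {set vertex n * vertex n} :=
  [set a | edge G a.1 a.2 && (vcoord x a.2 < vcoord x a.1)]%SET.

Lemma vcoord_neq (G : symGraph n) x u v :
  (~` Btor G) x -> edge G u v -> vcoord x u != vcoord x v.
Proof.
move=> nB.
have nH H : hyperplanes G H -> ~ H (coords x).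
  by move=> hH Hx; apply: nB; exists H => //; exists (coords x) => //;
    exact: to_torus_coords.
have zp i : edge G v0 (vpos i) -> coords x 0 i != 0.
  by move=> /hyp_zero/nH e; apply/eqP.
have pp i j : edge G (vpos i) (vpos j) -> coords x 0 i != coords x 0 j.
  case: (ltngtP i j) => [ij|ji|/val_inj ->]; last by rewrite edge_irr.
  - by move=> /(hyp_diff ij)/nH e; rewrite -subr_eq0; apply/eqP.
  - rewrite edge_sym eq_sym => /(hyp_diff ji)/nH e.
    by rewrite -subr_eq0; apply/eqP.
have pn i j : edge G (vpos i) (vneg j) -> coords x 0 i != - coords x 0 j.
  rewrite -addr_eq0; case: (ltngtP i j) => [ij|ji|/val_inj ->].
  - by move=> /(hyp_sum ij)/nH e; apply/eqP.
  - rewrite edge_sym => /edge_opp /= /(hyp_sum ji)/nH e.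
    by rewrite addrC; apply/eqP.
  - move=> /hyp_opp_zero/nH e; rewrite -mulr2n mulrn_eq0 /=; exact/eqP.
case: u v => [[i|i]|] [[j|j]|] //=.
- exact: pp.
- exact: pn.
- by rewrite edge_sym => /zp.
- by rewrite edge_sym eq_sym => /pn.
- by move=> /edge_opp /= /pp; rewrite eqr_opp.
- by rewrite edge_sym => /edge_opp /= /zp; rewrite oppr_eq0.
- by move=> /zp c0; rewrite eq_sym.
- by move=> /edge_opp /= /zp c0; rewrite eq_sym oppr_eq0.
- by rewrite edge_irr.
Qed.

Lemma omega_sym_acyclic (G : symGraph n) x :
  (~` Btor G) x -> sym_acyclic G (omega G x).
Proof.
move=> nB; split.
- split=> u v; rewrite /dir !inE /=; first by case/andP.
  move=> e; rewrite [edge G v u]edge_sym e /=.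
  by case: ltgtP (vcoord_neq nB e).
- move=> u v; rewrite /dir !inE /= edge_sym => /andP[e lt].
  by rewrite (edge_opp e) !vcoord_opp ltrN2.
- case=> // a c /= pc; exfalso.
  have tr : transitive (fun u v : vertex n => vcoord x v < vcoord x u).
    by move=> v u t h1 h2; exact: lt_trans h2 h1.
  have : path (fun u v => vcoord x v < vcoord x u) a (rcons c a).
    by apply: sub_path pc => u v; rewrite /dir inE => /andP[].
  move=> /(order_path_min tr)/allP/(_ a).
  by rewrite mem_rcons mem_head ltxx => /(_ isT).
Qed.

Definition offBtor (G : symGraph n) : Type := set_type (~` Btor G).

Definition beta (G : symGraph n) (x : offBtor G) : Acyc G :=
  Sub (omega G (val x))
    (introT (asboolP _) (omega_sym_acyclic (set_valP x))).

Definition chamber_of (G : symGraph n) (x : torus) : set torus :=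
  connected_component (~` Btor G) x.

Definition Chambers (G : symGraph n) : set (set torus) :=
  chamber_of G @` (~` Btor G).

Definition Cham (G : symGraph n) : Type := set_type (Chambers G).

Definition chamber (G : symGraph n) (x : offBtor G) : Cham G :=
  SigSub (mem_set (imageP (chamber_of G) (set_valP x))).

End Torus.

Arguments Cham R {n} G.
Arguments offBtor R {n} G.
Arguments Btor R {n} G.

(* Main.v *)
Require Import Defs.
From HB Require Import structures.
From mathcomp Require Import all_boot all_order all_algebra.
From mathcomp Require Import all_classical all_reals all_analysis.
From mathcomp Require Import zify lra.

Set Implicit Arguments.
Unset Strict Implicit.
Unset Printing Implicit Defensive.
Import Order.TTheory GRing.Theory Num.Theory.
Import numFieldNormedType.Exports.
Local Open Scope ring_scope.

(** Extend z in R^n oddly to the vertices, so that z_{-i} = - z_i and z_0 = 0.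
    Then pi(z) avoids the toric arrangement iff z_u - z_v is not an integer for
    every edge uv: one condition covers all five families of hyperplanes, as
    the edge v_i v_{-i} says that 2 z_i is not an integer.

    Attach to a symmetric acyclic orientation w the open convex set Lift w of
    those z for which 0 < z_u - z_v < 1 along every arc u -> v.  It consists of
    points off the arrangement, so its image in the torus lies in one chamber.
    The centered coordinates of a point x lie in Lift (omega x)
    ([Lift_coords]), and no Lift w is empty, since an acyclic orientation has a
    height function that can be scaled down ([Lift_neq0]).

    A flip at a source v is an integer translation: with e_v the basis vector
    of v, where e_{-i} = - e_i, one has z in Lift w iff z - e_v is in the Lift
    of the flipped orientation: a step z_v - z_u in ]0, 1[ turns into the step
    z_u - (z_v - 1) in ]0, 1[ ([unit_steps_reverse]).  Hence all the Lift w for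
    w in one flip class project into the same chamber, which shows that
    flip-equivalent points share a chamber ([flip_eqv_component]).

    Conversely, if z is in Lift w and z - m in Lift w' for an integer vector m,
    then w and w' are flip equivalent ([flip_eqv_of_shift]): among the vertices
    where m is maximal, one with z maximal is a source of w, and flipping
    there decreases the total size of m.  So the points whose orientation lies
    in a given flip class form the image of the translates of open sets Lift w;
    the flip classes cut the complement of the arrangement into disjoint open
    pieces, and a connected set stays inside one of them
    ([connected_flip_eqv]). *)

(** * Symmetric orientations and flips *)

Section Combinatorics.
Context (n : nat) (G : symGraph n).
Implicit Types (w : {set vertex n * vertex n}) (u v : vertex n).

Definition odd_ext (T : zmodType) (a : 'I_n -> T) (v : vertex n) : T :=
  match v with
  | None => 0
  | Some (inl i) => a i
  | Some (inr i) => - a i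
  end.

Lemma odd_ext_opp (T : zmodType) (a : 'I_n -> T) v :
  odd_ext a (vopp v) = - odd_ext a v.
Proof. by case: v => [[i|i]|] /=; rewrite ?opprK ?oppr0. Qed.

Lemma vopp_eq u v : (vopp u == vopp v) = (u == v).
Proof. exact: (inj_eq (inv_inj (@voppK n))). Qed.

Lemma vopp_eqC u v : (vopp u == v) = (u == vopp v).
Proof. by rewrite -{1}(voppK v) vopp_eq. Qed.

Lemma vopp_fix v : (vopp v == v) = (v == v0).
Proof. by case: v => [[i|i]|]. Qed.

Lemma touches_opp v a b : touches v (vopp b, vopp a) = touches v (a, b).
Proof.
by rewrite /touches /= !vopp_eqC !voppK; case: (a == v); case: (a == vopp v);
  case: (b == v); case: (b == vopp v).
Qed.

Lemma dir_reverse w v a b :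
  dir (reverse_at w v) a b = if touches v (a, b) then dir w b a else dir w a b.
Proof. by rewrite /dir inE. Qed.

(** The height of a vertex is the number of vertices reachable from it. *)
Lemma acyclic_height w : acyclic w ->
  {h : vertex n -> nat |
    forall u v, dir w u v -> (h v < h u <= #|{: vertex n}|)%N}.
Proof.
move=> acw; exists (fun v => #|connect (dir w) v|) => u v uv.
rewrite max_card andbT; apply/proper_card/properP; split.
  by apply/fintype.subsetP => t; apply: connect_trans; exact: connect1.
exists u; first by rewrite inE connect0.
rewrite inE; apply/negP => /connectP[p pp up].
suff /acw : cycle (dir w) (v :: p) by [].
by rewrite /= rcons_path pp -up.
Qed.

Lemma source_opp_sink w v : sym_orientation w ->
  is_source w v -> is_sink w (vopp v).
Proof.
move=> sw /forallP s; apply/forallP => u; apply/negP => /sw.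
by rewrite voppK; apply/negP.
Qed.

Lemma sink_opp_source w v : sym_orientation w ->
  is_sink w v -> is_source w (vopp v).
Proof.
move=> sw /forallP s; apply/forallP => u; apply/negP => /sw.
by rewrite voppK; apply/negP.
Qed.

Lemma reverse_at_opp w v : reverse_at w (vopp v) = reverse_at w v.
Proof.
apply/setP => -[a b]; rewrite !inE /= /touches /= voppK.
by case: (a == v); case: (a == vopp v); case: (b == v); case: (b == vopp v).
Qed.

Lemma cycle_neither w c v : cycle (dir w) c -> v \in c ->
  ~~ is_source w v && ~~ is_sink w v.
Proof.
move=> cc vc; apply/andP; split; apply/forallPn.
  by exists (prev c v); rewrite negbK; exact: prev_cycle.
by exists (next c v); rewrite negbK; exact: next_cycle.
Qed.

(** A directed cycle has no source and no sink, so after the reversal it cannot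
    visit v or vopp v, and its arcs are arcs of w. *)
Lemma reverse_sym_acyclic w v : sym_acyclic G w -> is_source w v ->
  sym_acyclic G (reverse_at w v).
Proof.
move=> [[sub tot] sw acw] src.
have sw' : sym_orientation (reverse_at w v).
  by move=> a b; rewrite !dir_reverse touches_opp; case: ifP => _; exact: sw.
have snk : is_sink (reverse_at w v) v.
  apply/forallP => u; rewrite dir_reverse /touches eqxx /=.
  exact: (forallP src).
have src' := sink_opp_source sw' snk.
split => //.
  split=> a b.
    by rewrite dir_reverse edge_sym; case: ifP => _ /sub; rewrite // edge_sym.
  by move=> /tot; rewrite !dir_reverse -touchesC; case: ifP; rewrite // addbC.
move=> c cc; apply: acw.
have neither a : a \in c -> (a != v) && (a != vopp v).
  move=> /(cycle_neither cc) /andP[n1 n2]; apply/andP; split.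
    by apply: contraNneq n2 => ->.
  by apply: contraNneq n1 => ->.
apply: (@sub_in_cycle _ [in c] (dir (reverse_at w v))) (cc); last exact/allP.
move=> a b /neither/andP[/negPf a1 /negPf a2].
move=> /neither/andP[/negPf b1 /negPf b2].
by rewrite dir_reverse /touches /= a1 a2 b1 b2.
Qed.

(** A flip at a sink v is also the flip at the source vopp v. *)
Lemma flip_source (w w' : Acyc G) : flip w w' -> exists v,
  [/\ v != v0, ~~ edge G v (vopp v), is_source (val w) v
    & val w' = reverse_at (val w) v].
Proof.
case/existsP => v /andP[/and3P[vn0 ev ss] /eqP e].
have [_ sw _] := asboolP _ (valP w).
case/orP: ss => [src|/(sink_opp_source sw) src]; first by exists v.
exists (vopp v).
by split; rewrite ?reverse_at_opp ?voppK ?[edge G _ v]edge_sym // vopp_eqC.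
Qed.

(** * Potentials with steps in the unit interval *)

Definition unit_steps (R : realFieldType) w (f : vertex n -> R) : Prop :=
  forall u v, dir w u v -> 0 < f u - f v < 1.

(** The odd extension of the basis vector of v, where that of vneg i is the
    opposite of that of vpos i. *)
Definition pulse v u : int := (u == v)%:Z - (u == vopp v)%:Z.

Lemma pulse_opp v u : pulse v (vopp u) = - pulse v u.
Proof. by rewrite /pulse vopp_eq vopp_eqC opprB. Qed.

Section Steps.
Context (R : realFieldType).
Implicit Type f : vertex n -> R.

Lemma edge_step w f u v : orientation G w -> unit_steps w f -> edge G u v ->
  dir w u v /\ 0 < f u - f v < 1 \/ dir w v u /\ 0 < f v - f u < 1.
Proof.
move=> [_ tot] st /tot; case uv : (dir w u v) => /=.
  by left; split=> //; apply: st.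
by case vu : (dir w v u) => // _; right; split=> //; apply: st.
Qed.

(** A flip at a source v is a translation by - [pulse v]: reversing an arc
    changes its step from t to 1 - t, and each reversed arc meets exactly one
    of v, vopp v because these two are not adjacent. *)
Lemma unit_steps_reverse w f v : sym_acyclic G w -> unit_steps w f ->
  is_source w v -> ~~ edge G v (vopp v) ->
  unit_steps (reverse_at w v) (fun u => f u - (pulse v u)%:~R).
Proof.
move=> [[sub _] sw _] st src nev a b; rewrite dir_reverse.
have snk := source_opp_sink sw src.
case: ifPn => [tch ba|ntch ab].
- have -> : pulse v a = pulse v b - 1.
    have av : a != v by apply: contraTneq ba => ->; exact: (forallP src).
    have bv : b != vopp v by apply: contraTneq ba => ->; exact: (forallP snk).
    move: tch; rewrite /touches /pulse /= (negPf av) (negPf bv) /= orbF.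
    case: (eqVneq a (vopp v)) ba => [->|_];
      case: (eqVneq b v) => [->|_] //= /sub.
    by rewrite (negPf nev).
  rewrite rmorphB /= mulr1z; have /andP[] := st _ _ ba.
  move: (f a) (f b) (_%:~R : R) => x y k ? ?.
  apply/andP; split; lra.
- move: ntch; rewrite /touches /pulse /= !negb_or.
  case/and4P => /negPf-> /negPf-> /negPf-> /negPf->.
  by rewrite !subr0; exact: st.
Qed.

Lemma orientation_unit_steps_eq w w' f : orientation G w -> orientation G w' ->
  unit_steps w f -> unit_steps w' f -> w = w'.
Proof.
move=> ow ow' st st'.
have sub x y : orientation G x -> orientation G y ->
    unit_steps x f -> unit_steps y f -> forall u v, dir x u v -> dir y u v.
  move=> [ox _] oy stx sty u v xuv.
  have /andP[lt _] := stx _ _ xuv.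
  have [[]//|[_ /andP[lt' _]]] := edge_step oy sty (ox _ _ xuv).
  lra.
by apply/setP => -[a b]; apply/idP/idP; apply: sub.
Qed.

(** Induction on the total size of m.  If m is nonzero, its maximum is positive
    since m is odd.  Across an edge us with m u < m s, the step of f - m lies in
    ]-1, 1[, so f u < f s; a maximum of f among the maxima of m is
    therefore a source of w.  Flipping there moves m one unit towards 0. *)
Lemma flip_eqv_of_shift (w w' : Acyc G) f (m : vertex n -> int) :
  (forall v, m (vopp v) = - m v) ->
  unit_steps (val w) f -> unit_steps (val w') (fun v => f v - (m v)%:~R) ->
  flip_eqv w w'.
Proof.
have [N] := ubnP (\sum_v `|m v|)%N.
elim: N => // N IH in w f m *; rewrite ltnS => leN modd st st'.
have [ow _ _] := asboolP _ (valP w); have [ow' _ _] := asboolP _ (valP w').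
have m0 : m v0 = 0 by have := modd v0; rewrite /=; lia.
case: (@Order.TotalTheory.arg_maxP _ _ _ v0 xpredT m) => // t _ tmax.
have [tle0|tgt0] := lerP (m t) 0.
  have mz v : m v = 0.
    have := tmax v isT; have := tmax (vopp v) isT; rewrite modd /=; lia.
  suff -> : w = w' by apply: flip_eqv_refl.
  apply/val_inj/(orientation_unit_steps_eq ow ow' st).
  by move=> u v /st'; rewrite !mz !subr0.
case: (@Order.TotalTheory.arg_maxP _ _ _ t (fun v => m v == m t) f) => //.
move=> s /eqP smt smax.
have mle v : m v <= m s by rewrite smt; exact: tmax.
have ms1 : 1 <= (m s)%:~R :> R by rewrite ler1z smt.
have src : is_source (val w) s.
  apply/forallP => a; apply/negP => as_.
  have /andP[lo hi] := st _ _ as_.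
  have mas : m a != m s.
    apply/eqP => e; have := smax a; rewrite e smt eqxx => /(_ isT) /=; lra.
  have ge1 : 1 <= (m s)%:~R - (m a)%:~R :> R.
    by rewrite -rmorphB /= ler1z; have := mle a; lia.
  by case: (edge_step ow' st' (ow.1 _ _ as_)) => -[_ /andP[]] /=; lra.
(* An edge between s and vopp s would have a step of f - m below 1 - 2 m s. *)
have nev : ~~ edge G s (vopp s).
  apply/negP => e; case: (edge_step ow' st' e) => -[_];
  case: (edge_step ow st e) => -[_]; rewrite modd rmorphN /=; lra.
have sn0 : s != v0 by apply: contraTneq tgt0 => e; rewrite -smt e m0.
have ac1 := reverse_sym_acyclic (asboolP _ (valP w)) src.
pose w1 : Acyc G :=
  exist _ (reverse_at (val w) s) (introT (asboolP _) ac1).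
have fl : flip w w1.
  by apply/existsP; exists s; rewrite /source_sink sn0 nev src /=.
apply: (flip_eqv_trans (connect1 fl)).
apply: (IH w1 (fun v => f v - (pulse s v)%:~R) (fun v => m v - pulse s v)).
- apply: leq_trans leN; rewrite (bigD1 s) //= [X in (_ < X)%N](bigD1 s) //=.
  rewrite -addSn leq_add //; last apply: leq_sum => i /negPf ns.
    rewrite /pulse eqxx; have := vopp_fix s.
    by rewrite eq_sym (negPf sn0) => ->; lia.
  rewrite /pulse ns; case: eqP => [->|_]; rewrite ?modd; lia.
- by move=> v; rewrite modd pulse_opp; lia.
- exact: (unit_steps_reverse (asboolP _ (valP w)) st src nev).
- by move=> u v /st'; rewrite !rmorphB /=; lra.
Qed.

End Steps.
End Combinatorics.

(** * Lifts of an orientation to euclidean space *)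

Section TorusLifts.
Context (R : realType) (n : nat) (G : symGraph n).
Local Open Scope classical_set_scope.

Definition Lift (w : {set vertex n * vertex n}) : set 'rV[R]_n :=
  [set z | unit_steps w (odd_ext (z 0))].

Lemma vcoordE (x : torus R n) v : vcoord x v = odd_ext (coords x 0) v.
Proof. by []. Qed.

Lemma odd_ext_shift (z : 'rV[R]_n) (m : vertex n -> int) v :
  (forall u, m (vopp u) = - m u) ->
  odd_ext ((z - \row_i (m (vpos i))%:~R) 0) v = odd_ext (z 0) v - (m v)%:~R.
Proof.
move=> modd; case: v => [[i|i]|] /=; rewrite ?mxE //.
  have -> : m (Some (inr i)) = - m (vpos i) by exact: (modd (vpos i)).
  by rewrite rmorphN /= opprD opprK.
have e0 : m None = - m None := modd v0.
have -> : m None = 0 by lia.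
by rewrite subr0.
Qed.

Lemma torus_shift (z z' : 'rV[R]_n) : to_torus z = to_torus z' ->
  exists m : vertex n -> int, (forall v, m (vopp v) = - m v) /\
    forall v, odd_ext (z' 0) v = odd_ext (z 0) v - (m v)%:~R.
Proof.
move=> /to_torusP zz'.
have [k kE] := choice (fun i => elimT intrP (zz' i)).
exists (odd_ext k); split=> [v|[[i|i]|]] /=; first exact: odd_ext_opp.
- by rewrite -kE; lra.
- by rewrite rmorphN /= -kE; lra.
- by rewrite subr0.
Qed.

(** Every hyperplane of the arrangement makes the step of its edge an integer,
    and a lattice translation changes steps by integers. *)
Lemma off_Btor (z : 'rV[R]_n) :
  (forall u v, edge G u v ->
    odd_ext (z 0) u - odd_ext (z 0) v \isn't a Num.int) ->
  (~` Btor R G) (to_torus z).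
Proof.
move=> nint [H hH [y Hy /torus_shift[m [_ zE]]]].
have key u v : edge G u v ->
    odd_ext (y 0) u - odd_ext (y 0) v \isn't a Num.int.
  move=> /nint; apply: contraNN => yint; rewrite !zE opprD addrACA.
  by rewrite rpredD // rpredB ?rpredN ?intr_int.
case: hH Hy => [i j _|i j _|i|i|i] /key + /= e; apply/negP; rewrite negbK /=.
- by rewrite e.
- by rewrite opprK e.
- by rewrite e subr0.
- by rewrite e opprK addr0.
- by rewrite opprK -mulr2n -mulr_natl e.
Qed.

Lemma Lift_off w z : orientation G w -> Lift w z -> (~` Btor R G) (to_torus z).
Proof.
move=> ow st; apply: off_Btor => u v e; apply/negP => /intrP[k kE].
case: (edge_step ow st e) => -[_]; rewrite -?[odd_ext _ v - _]opprB kE.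
  by rewrite ltr0z ltrz1; lia.
by rewrite -rmorphN /= ltr0z ltrz1; lia.
Qed.

(** Centered coordinates differ by at most 1 along an edge.  A difference of
    exactly 1 needs the coordinates 1/2 of v_i and -1/2 of v_{-j}; then
    x_i + x_j = 1, and x is on the arrangement. *)
Lemma Lift_coords (x : torus R n) :
  (~` Btor R G) x -> Lift (omega G x) (coords x).
Proof.
move=> nB u v; rewrite /dir inE /= => /andP[e lt].
rewrite -!vcoordE subr_gt0 lt /= ltrBlDr.
have bnd t : - 2^-1 <= vcoord x t <= 2^-1.
  by case: t => [[i|i]|] /=;
    [have := coords_itv x i|have := coords_itv x i|]; lra.
rewrite lt_neqAle andbC; apply/andP; split.
  by have := bnd u; have := bnd v; lra.
apply/eqP => e1.
have [eu ev] : vcoord x u = 2^-1 /\ vcoord x v = - 2^-1.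
  by have := bnd u; have := bnd v; lra.
case: u v eu ev e {lt e1} => [[i|i]|] [[j|j]|] /=; try lra.
- by have := coords_itv x j; lra.
- move=> ci cj e; apply: nB; rewrite -(to_torus_coords x).
  move: (coords x) ci cj => c ci cj.
  have shift k : to_torus (c - delta_mx 0 k) = to_torus c.
    apply/to_torusP => l; rewrite !mxE [_ - c 0 l]addrC addKr rpredN.
    by case: (_ && _); rewrite ?rpred0 ?rpred1.
  case: (ltngtP i j) => [ij|ji|/val_inj ij].
  + exists [set y | y 0 i + y 0 j = 0]; first exact: (hyp_sum R ij e).
    exists (c - delta_mx 0 j); last exact: shift.
    by rewrite /= !mxE !eqxx /= -!val_eqE /= (ltn_eqF ij) /=; lra.
  + have e' : edge G (vpos j) (vneg i) by rewrite edge_sym; apply: (edge_opp e).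
    exists [set y | y 0 j + y 0 i = 0]; first exact: (hyp_sum R ji e').
    exists (c - delta_mx 0 j); last exact: shift.
    by rewrite /= !mxE !eqxx /= -!val_eqE /= (gtn_eqF ji) /=; lra.
  + exists [set y | 2 * y 0 i = 1]; first by apply: hyp_opp_half; rewrite {2}ij.
    by exists c => //=; lra.
- by have := coords_itv x i; lra.
- by have := coords_itv x i; lra.
Qed.

(** The odd part of a height function decreases along every arc u -> v, since
    vopp v -> vopp u is an arc too; dividing by a bound makes the steps
    smaller than 1. *)
Lemma Lift_neq0 w : sym_acyclic G w -> Lift w !=set0.
Proof.
move=> [_ sw /acyclic_height[h hh]].
(* Heights lie between 0 and the number of vertices, so that a step of their
   odd part is at most twice this number. *)
pose N : R := 2 * #|{: vertex n}|%:R + 1.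
have N0 : 0 < N by rewrite /N ltr_wpDl // mulr_ge0.
exists (\row_i (((h (vpos i))%:R - (h (vneg i))%:R) / N)) => u v uv.
have zE t :
    odd_ext ((\row_i (((h (vpos i))%:R - (h (vneg i))%:R) / N)) 0) t =
    ((h t)%:R - (h (vopp t))%:R) / N.
  case: t => [[i|i]|] /=; rewrite ?mxE // ?subrr ?mul0r //.
  by rewrite -mulNr opprB.
have /andP[lt1 le1] := hh _ _ uv.
have /andP[lt2 le2] := hh _ _ (sw _ _ uv).
rewrite !zE -mulrBl divr_gt0 //= ?ltr_pdivrMr // ?mul1r.
  move: lt1 le1 lt2 le2; rewrite -!(ltr_nat R) -!(ler_nat R) /N.
  have := ler0n R (h v); have := ler0n R (h (vopp u)); lra.
by move: lt1 lt2; rewrite -!(ltr_nat R); lra.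
Qed.

Lemma Lift_segment w z z' (t : R) : 0 <= t <= 1 ->
  Lift w z -> Lift w z' -> Lift w (z + t *: (z' - z)).
Proof.
move=> /andP[t0 t1] st st' u v uv.
have E a : odd_ext ((z + t *: (z' - z)) 0) a =
    odd_ext (z 0) a + t * (odd_ext (z' 0) a - odd_ext (z 0) a).
  by case: a => [[i|i]|] /=; rewrite ?mxE //; lra.
have pos p q : 0 < p -> 0 < q -> 0 < p + t * (q - p).
  move=> p0 q0.
  have t1' : 0 <= (1 - t) * p by rewrite mulr_ge0 ?subr_ge0 // ltW.
  have [tgt0|tle0] := ltrP 0 t; first by have := mulr_gt0 tgt0 q0; lra.
  have tz : t = 0 by lra.
  by rewrite tz mul0r addr0.
have := st _ _ uv; have := st' _ _ uv; rewrite !E.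
move: (odd_ext (z 0) u) (odd_ext (z 0) v) (odd_ext (z' 0) u) (odd_ext (z' 0) v).
move=> a b c d /andP[cd0 cd1] /andP[ab0 ab1].
have := pos _ _ ab0 cd0.
(* The upper bound is positivity for the complements to 1 of the steps. *)
have := pos (1 - (a - b)) (1 - (c - d)); rewrite !subr_gt0.
by move=> /(_ ab1 cd1); lra.
Qed.

Lemma Lift_component w z z' : orientation G w -> Lift w z -> Lift w z' ->
  connected_component (~` Btor R G) (to_torus z) (to_torus z').
Proof.
move=> ow st st'.
pose g (t : R) : torus R n := to_torus (z + t *: (z' - z)).
have in01 (t : R) : 0 <= t <= 1 -> `[0, 1] t by rewrite /= in_itv.
apply: (@connected_component_max _ _ (g @` `[0, 1])).
- exists 0; first by apply: in01; rewrite lexx ler01.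
  by rewrite /g scale0r addr0.
- move=> _ [t + <-]; rewrite /= in_itv /= => t01.
  by apply: (Lift_off ow); exact: Lift_segment.
- apply: connected_continuous_connected; first exact: segment_connected.
  apply: continuous_subspaceT => t.
  apply: continuous_comp; last exact: pi_continuous.
  by apply: continuousD; [exact: cst_continuous|apply: scalel_continuous].
- exists 1; first by apply: in01; rewrite lexx ler01.
  by rewrite /g scale1r addrC subrK.
Qed.

Lemma Lift_open w z : Lift w z -> \forall z' \near z, Lift w z'.
Proof.
move=> st.
have ext_cont v : {for z, continuous (fun z' : 'rV[R]_n => odd_ext (z' 0) v)}.
  case: v => [[i|i]|] /=; first exact: coord_continuous.
    by apply: continuousN; exact: coord_continuous.
  exact: cst_continuous.
have arcs (a : vertex n * vertex n) : \forall z' \near z, dir w a.1 a.2 ->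
    0 < odd_ext ((z' : 'rV[R]_n) 0) a.1 - odd_ext ((z' : 'rV[R]_n) 0) a.2 < 1.
  case: a => u v /=; have [uv|_] := boolP (dir w u v).
    2: by apply: (@nearW _ (nbhs z)).
  have cont : {for z, continuous
      (fun z' : 'rV[R]_n => odd_ext (z' 0) u - odd_ext (z' 0) v)}.
    by apply: continuousB; exact: ext_cont.
  have /andP[lo hi] := st _ _ uv.
  near=> z' => _; apply/andP; split; near: z'.
    exact: (cont _ (lt_nbhsr lo)).
  exact: (cont _ (lt_nbhsl hi)).
by apply: (filterS _ (filter_forall _ arcs)) => z' h u v; exact: (h (u, v)).
Unshelve. all: by end_near. Qed.

(** * Flip classes and chambers *)

Lemma flip_eqv_beta (w : Acyc G) z (x : offBtor R G) :
  Lift (val w) z -> to_torus z = val x -> flip_eqv w (beta x).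
Proof.
rewrite -[RHS]to_torus_coords => st /torus_shift[m [modd mE]].
apply: (flip_eqv_of_shift modd st) => u v uv; rewrite -!mE.
exact: (Lift_coords (set_valP x) uv).
Qed.

(** A flip replaces a lift by a translate with the same image in the torus, so a
    chain of flips reduces to the convexity of a single Lift. *)
Lemma flip_eqv_component (w w' : Acyc G) z z' : flip_eqv w w' ->
  Lift (val w) z -> Lift (val w') z' ->
  connected_component (~` Btor R G) (to_torus z) (to_torus z').
Proof.
move=> /connectP[p pp ->] {w'}; elim: p w z pp => [|w1 p IH] w z /=.
  by move=> _; apply: Lift_component; case: (asboolP _ (valP w)).
move=> /andP[/flip_source[v [_ nev src e]] pp] st.
pose z1 := z - \row_i (pulse v (vpos i))%:~R.
have -> : to_torus z = to_torus z1.
  by apply/to_torusP => i; rewrite !mxE opprB addrC subrK intr_int.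
apply: IH => // a b; rewrite e => ab.
rewrite !odd_ext_shift; try exact: pulse_opp.
exact: (unit_steps_reverse (asboolP _ (valP w)) st src nev ab).
Qed.

(** The points whose orientation is in the flip class of w (see [class_locusP]),
    written with lifts so that openness is inherited from Lift. *)
Definition class_locus (w : Acyc G) : set (torus R n) :=
  [set p | exists w' z, [/\ flip_eqv w w', Lift (val w') z & to_torus z = p]].

Lemma class_locusP w (x : offBtor R G) :
  class_locus w (val x) <-> flip_eqv w (beta x).
Proof.
split=> [[w' [z [ww' st /(flip_eqv_beta st)]]]|wx].
  exact: flip_eqv_trans.
exists (beta x), (coords (val x)); split => //; last exact: to_torus_coords.
exact/Lift_coords/set_valP.
Qed.

Lemma open_class_locus w : open (class_locus w).
Proof.
(* A set is open in the quotient topology iff its preimage is open. *)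
suff : open ((@to_torus R n) @^-1` class_locus w) by [].
rewrite openE => z /= [w' [z0 [ww' st /esym zz0]]].
have [m [modd mE]] := torus_shift zz0.
pose k : 'rV[R]_n := \row_i (m (vpos i))%:~R.
have kE z' v : odd_ext ((z' - k) 0) v = odd_ext (z' 0) v - (m v)%:~R.
  exact: odd_ext_shift.
have stk : Lift (val w') (z - k) by move=> u v uv; rewrite !kE -!mE; exact: st.
have cont : {for z, continuous (fun z' : 'rV[R]_n => z' - k)}.
  by apply: continuousB; [exact: cvg_id|exact: cst_continuous].
have near_st : \forall z' \near z, Lift (val w') (z' - k) :=
  cont _ (Lift_open stk).
rewrite /interior /=; apply: filterS near_st => z' /= st'.
exists w', (z' - k); split => //; apply/to_torusP => i.
by rewrite !mxE [_ - z' 0 i]addrC addKr rpredN intr_int.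
Qed.

(** The locus of the class of beta x and the union of the loci of the other
    classes are disjoint open sets that cover B. *)
Lemma connected_flip_eqv (B : set (torus R n)) (x y : offBtor R G) :
  connected B -> B `<=` ~` Btor R G -> B (val x) -> B (val y) ->
  flip_eqv (beta x) (beta y).
Proof.
move=> cB sB Bx By.
have offE p : B p -> exists q : offBtor R G, val q = p.
  by move=> /sB nBp; exists (SigSub (mem_set nBp)).
have eB : B `&` class_locus (beta x) = B.
  apply: cB.
  - by exists (val x); split => //; apply/class_locusP; exact: flip_eqv_refl.
  - by exists (class_locus (beta x)) => //; exact: open_class_locus.
  - exists (~` \bigcup_(w in [set w | ~~ flip_eqv (beta x) w]) class_locus w).
      apply: open_closedC; apply: bigcup_open => w _; exact: open_class_locus.
    apply/seteqP; split=> p [Bp]; have [q qp] := offE _ Bp; rewrite -qp.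
    + move=> /class_locusP xq; split; rewrite ?qp // -qp.
      move=> -[w /= xw /class_locusP wq].
      by move/negP: xw; apply; apply: flip_eqv_trans xq _; rewrite flip_eqv_sym.
    + move=> nq; split; rewrite ?qp // -qp; apply/class_locusP/negPn/negP => xq.
      apply: nq; exists (beta q) => //.
      by apply/class_locusP; exact: flip_eqv_refl.
by apply/class_locusP; move: By; rewrite -eB => -[].
Qed.

Lemma chamber_eqP (x y : offBtor R G) :
  chamber x = chamber y <-> flip_eqv (beta x) (beta y).
Proof.
have xoff : (~` Btor R G) (val x) := set_valP x.
have yoff : (~` Btor R G) (val y) := set_valP y.
split=> [/(congr1 val) /= e|xy].
  have [B [Bx sB cB] By] : connected_component (~` Btor R G) (val x) (val y).
    by rewrite [X in X _]e; exact: connected_component_refl.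
  exact: (connected_flip_eqv cB sB Bx By).
apply: val_inj; apply: same_connected_component.
rewrite -(to_torus_coords (val x)) -(to_torus_coords (val y)).
exact: (flip_eqv_component xy (Lift_coords xoff) (Lift_coords yoff)).
Qed.

Lemma beta_surj (w : Acyc G) : exists x : offBtor R G, flip_eqv w (beta x).
Proof.
have sa := asboolP _ (valP w); have [z st] := Lift_neq0 sa.
have [ow _ _] := sa; have zoff := Lift_off ow st.
by exists (SigSub (mem_set zoff)); apply: (flip_eqv_beta st).
Qed.

Lemma chamber_surj (c : Cham R G) : exists x : offBtor R G, chamber x = c.
Proof.
have [p poff pc] := set_valP c.
by exists (SigSub (mem_set poff)); apply: val_inj.
Qed.

End TorusLifts.

Theorem theorem4p4 (R : realType) (n : nat) (G : symGraph n) :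
  (exists beta_bar : Cham R G -> AcycClasses G,
     bijective beta_bar /\
     forall x : offBtor R G,
       beta_bar (chamber x) = (\pi_(AcycClasses G) (beta x))%qT) /\
  (forall x y : offBtor R G,
     chamber x = chamber y <-> flip_eqv (beta x) (beta y)) /\
  (forall c : AcycClasses G, exists x : offBtor R G,
     c = (\pi_(AcycClasses G) (beta x))%qT).
Proof.
pose cls (x : offBtor R G) : AcycClasses G :=
  (\pi_(AcycClasses G) (beta x))%qT.
have clsP x y : cls x = cls y <-> flip_eqv (beta x) (beta y).
  by split=> [/eqmodP|e]; last exact/eqmodP.
have surj c : exists x, c = cls x.
  have [x wx] := beta_surj R (repr c); exists x.
  by rewrite -[c]reprK; apply/eqmodP.
split; last by split=> //; exact: chamber_eqP.
have [pt ptK] := choice (@chamber_surj R n G).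
have [pt' pt'K] := choice surj.
(* Chambers and flip classes are both quotients of the complement of the
   arrangement by the same equivalence; a choice of points gives both maps. *)
exists (cls \o pt); split; last first.
  by move=> x; apply/clsP/chamber_eqP; rewrite ptK.
exists (@chamber R n G \o pt') => c /=.
  by rewrite -[RHS]ptK; apply/chamber_eqP/clsP; rewrite -pt'K.
by rewrite [RHS]pt'K; apply/clsP/chamber_eqP; rewrite ptK.
Qed.
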